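(* Let $\alpha,\beta\in\mathbb{R}$ with $\beta\neq0$, let $s<-1/4$ and $b\in\mathbb{R}$. Then the trilinear estimate $$\|uv\overline{w}\|_{X^{s,b-1}}\le C\,\|u\|_{X^{s,b}}\|v\|_{X^{s,b}}\|w\|_{X^{s,b}}$$ fails; that is, there is no constant $C$ for which this inequality holds for all $u,v,w\in X^{s,b}$ whose product $uv\overline{w}$ is defined.
   Context: Notation: $\langle\xi\rangle=1+|\xi|$, $\phi(\xi)=\alpha\xi^2+\beta\xi^3$, and for $s,b\in\mathbb{R}$ $$\|u\|_{X^{s,b}}=\|\langle\xi\rangle^s\langle\tau-\phi(\xi)\rangle^b\hat u(\xi,\tau)\|_{L^2_\xi L^2_\tau},$$ where $\hat u$ is the Fourier transform of $u=u(x,t)$ in both variables; $X^{s,b}$ is the space of complex-valued tempered distributions on $\mathbb{R}^2$ whose Fourier transform is a measurable function with finite norm. The product $uv\overline{w}$ is understood through its Fourier transform, namely (up to a normalizing constant) the convolution $\hat u*\hat v*\widehat{\overline{w}}$, and is said to be defined when this convolution integral converges absolutely almost everywhere. The norm of the product is taken to be $+\infty$ if it is not in $X^{s,b-1}$. *)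

(* Defs.v *)
From HB Require Import structures.
From mathcomp Require Import all_boot all_order all_algebra.
From mathcomp Require Import complex.
From mathcomp Require Import all_classical all_reals all_analysis.
Set Implicit Arguments.
Unset Strict Implicit.
Unset Printing Implicit Defensive.
Import Order.TTheory GRing.Theory Num.Theory.
Import numFieldNormedType.Exports.

Local Open Scope classical_set_scope.
Local Open Scope ring_scope.
Local Open Scope complex_scope.

Section ComplexValued.
Context {R : realType} {d : measure_display} {T : measurableType d}.
Implicit Types (mu : {measure set T -> \bar R}) (f : T -> complex R).

Definition Cmeasurable f : Prop :=
  measurable_fun setT (fun x => complex.Re (f x)) /\
  measurable_fun setT (fun x => complex.Im (f x)).

Definition Cintegrable mu f : Prop :=
  mu.-integrable setT (fun x => (complex.Re (f x))%:E) /\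
  mu.-integrable setT (fun x => (complex.Im (f x))%:E).

(* Only meaningful when [Cintegrable mu f]. *)
Definition Cintegral mu f : complex R :=
  (\int[mu]_x complex.Re (f x)) +i* (\int[mu]_x complex.Im (f x)).

End ComplexValued.

Section Plane.
Context {R : realType}.
Local Notation C := (complex R).
Local Notation mu := (@lebesgue_measure R).
Local Notation normC := (@Normc.normc R).

Definition leb2 : set (measurableTypeR R * measurableTypeR R) -> \bar R :=
  (mu \x mu)%E.
HB.instance Definition _ := Measure.on leb2.
Lemma leb2_sigma_finite : sigma_finite setT leb2.
Proof.
have /sigma_finiteP[F [TF ndF Foo]] := sigma_finiteT mu.
exists (fun n => F n `*` F n).
  rewrite -setXTT TF predeqE => -[x y]; split.
    move=> [/= [n _ Fnx] [k _ Fky]]; exists (maxn n k) => //; split.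
    - by move: x Fnx; exact/subsetPset/ndF/leq_maxl.
    - by move: y Fky; exact/subsetPset/ndF/leq_maxr.
  by move=> [n _ []/= ? ?]; split; exists n.
move=> k; have [? ?] := Foo k.
split; first exact: measurableX.
by rewrite /leb2 product_measure1E// lte_mul_pinfty// ge0_fin_numE.
Qed.
HB.instance Definition _ :=
  Measure_isSigmaFinite.Build _ _ _ leb2 leb2_sigma_finite.

Definition expi (x : R) : C := cos x +i* sin x.

(* [partial v f] is the derivative of [f] in the direction [v], taken on the
   real and imaginary parts. *)
Definition partial (v : R * R) (f : R * R -> C) : R * R -> C := fun p =>
  ('D_v (fun q => complex.Re (f q)) p) +i* ('D_v (fun q => complex.Im (f q)) p).

Definition pderiv (m n : nat) (f : R * R -> C) : R * R -> C :=
  iter m (partial (1, 0)) (iter n (partial (0, 1)) f).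

(* Differentiability of every d_x^m d_t^n f forces mixed partial derivatives to
   commute, so this is C^infinity smoothness. *)
Definition smooth (f : R * R -> C) : Prop := forall m n p,
  differentiable (fun q => complex.Re (pderiv m n f q)) p /\
  differentiable (fun q => complex.Im (pderiv m n f q)) p.

Definition seminorm (i j m n : nat) (f : R * R -> C) : \bar R :=
  ereal_sup (range (fun p : R * R =>
    (normC (pderiv m n f p) * (`|p.1| ^+ i * `|p.2| ^+ j))%:E)).

Definition schwartz (f : R * R -> C) : Prop :=
  smooth f /\ forall i j m n, (seminorm i j m n f < +oo)%E.

(* A tempered distribution is coded by a functional on all functions, of which
   only the values on Schwartz functions matter. *)
Definition functional := (R * R -> C) -> C.

Definition tempered (u : functional) : Prop :=
  [/\ (forall (a : C) f g, schwartz f -> schwartz g ->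
         u (fun p => a * f p + g p) = a * u f + u g)
    & exists (K : R) (N : nat), forall f, schwartz f ->
        ((normC (u f))%:E <=
         K%:E * \sum_(i < N) \sum_(j < N) \sum_(m < N) \sum_(n < N)
                  seminorm i j m n f)%E].

(* F f (xi, tau) = int exp(- i (x xi + t tau)) f(x, t) dx dt *)
Definition fourier (f : R * R -> C) : R * R -> C := fun q =>
  Cintegral leb2 (fun p => expi (- (p.1 * q.1 + p.2 * q.2)) * f p).

(* The Fourier transform of [u], which is the distribution f |-> u (fourier f),
   is the measurable function [F]. *)
Definition has_fourier (u : functional) (F : R * R -> C) : Prop :=
  Cmeasurable F /\ forall f, schwartz f ->
    Cintegrable leb2 (fun p => F p * f p) /\
    u (fourier f) = Cintegral leb2 (fun p => F p * f p).

Definition dconj (u : functional) : functional := fun f =>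
  conjc (u (fun p => conjc (f p))).

Definition bracket (x : R) : R := 1 + `|x|.

Definition phase (alpha beta xi : R) : R := alpha * xi ^+ 2 + beta * xi ^+ 3.

(* The X^{s,b} norm in terms of the Fourier transform [F]; it is [+oo] when the
   weighted function is not square integrable. *)
Definition Xnorm (alpha beta s b : R) (F : R * R -> C) : \bar R :=
  Lnorm mu 2%:E (fun xi => Lnorm mu 2%:E (fun tau =>
    (bracket xi `^ s * bracket (tau - phase alpha beta xi) `^ b *
     normC (F (xi, tau)))%:E)).

(* [u] belongs to X^{s,b}, with Fourier transform (a representative of) [F]. *)
Definition inX (alpha beta s b : R) (u : functional) (F : R * R -> C) : Prop :=
  [/\ tempered u, has_fourier u F & (Xnorm alpha beta s b F < +oo)%E].

Definition conv3_integrand (F G H : R * R -> C) (p : R * R)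
    (q : (R * R) * (R * R)) : C :=
  F q.1 * G q.2 * H (p.1 - q.1.1 - q.2.1, p.2 - q.1.2 - q.2.2).

(* Absolute convergence almost everywhere of the convolution integral. *)
Definition conv3_defined (F G H : R * R -> C) : Prop :=
  {ae leb2, forall p, Cintegrable (leb2 \x leb2)%E (conv3_integrand F G H p)}.

(* When [F], [G] and [H] are the Fourier transforms of u, v and w-bar, this is
   the Fourier transform of u v w-bar up to a normalizing constant; its value is
   irrelevant on the null set where the integral does not converge. *)
Definition conv3 (F G H : R * R -> C) : R * R -> C := fun p =>
  Cintegral (leb2 \x leb2)%E (conv3_integrand F G H p).

End Plane.

(* Main.v *)
Require Import Defs.
From HB Require Import structures.
From mathcomp Require Import all_boot all_order all_algebra.
From mathcomp Require Import complex.
From mathcomp Require Import all_classical all_reals all_analysis.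
From mathcomp Require Import measurable_realfun.
From mathcomp Require Import ring lra.

(** The estimate is tested on u = v = w equal to a single wave packet at a
high frequency N = n^2. Its Fourier transform is a bump on the parallelogram
|xi - N| <= a, |tau - phi(N) - phi'(N) (xi - N)| <= 1 with a = N^(-1/2) = 1/n.

Up to a constant, this is the largest width for which the cubic phase is linear
up to O(1) on the packet: by Taylor's formula, with h = xi - N,
phi(xi) - phi(N) - phi'(N) h = h^2 (alpha + 3 beta N + beta h), and
N h^2 <= N a^2 = 1. Hence the modulation weight lies between two constants
whatever b is ([bracket_modulation]), the frequency weight is comparable to
N^s, and ||u|| is at most of order N^s a^(1/2) ([Xnorm_le]). Since N + N - N = N,
the product of u, u and the conjugate of u concentrates near the same
parallelogram; its transform integrates over two factors of measure of order a each, so it is at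
least c a^2 near the centre ([conv3_tent_box_ge]) and the product has norm at
least c N^s a^(5/2) ([Xnorm_ge]). The estimate would force
N^s a^(5/2) <= C N^(3s) a^(3/2), that is n^(-1-4s) <= C for all n >= 1
([frequency_bound]). This is absurd when s < -1/4.

It remains to realise such a bump as the Fourier transform of a tempered
distribution. Fourier inversion is avoided by starting on the physical side:
an integrable density G defines a tempered distribution, and Fubini's theorem
shows that its Fourier transform is the function [fourier G]
([density_has_fourier]). The bump is a product of two tents in sheared
coordinates, and the tent is the transform of the Fejer kernel
(1 - cos x) / (K x^2), where K is the total mass of (1 - cos x) / x^2
([fourier_fejer]). That in turn follows from the scaling law
int (1 - cos (c x)) / x^2 dx = |c| K and the product formula for cosines, and
K never has to be evaluated. Scaling, shearing and modulating this kernel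
gives the density of the packet ([fourier_packet]). *)

Set Implicit Arguments.
Unset Strict Implicit.
Unset Printing Implicit Defensive.
Import Order.TTheory GRing.Theory Num.Theory.
Import numFieldNormedType.Exports.

Local Open Scope classical_set_scope.
Local Open Scope ring_scope.
Local Open Scope complex_scope.

(** * Complex-valued integrals *)

Section ComplexIntegral.
Context {R : realType}.
Local Notation C := (complex R).

(** Unlike the modulus, this norm is measurable and integrable by sums of
absolute values of components, and it is still submultiplicative, which is what
the domination arguments require. *)
Definition norm1 (z : C) : R := `|complex.Re z| + `|complex.Im z|.

Lemma norm1_ge0 z : 0 <= norm1 z.
Proof. by rewrite addr_ge0. Qed.

Lemma norm1M z w : norm1 (z * w) <= norm1 z * norm1 w.
Proof.
case: z => a b; case: w => c d; rewrite /norm1 /=.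
apply: (@le_trans _ _ ((`|a * c| + `|b * d|) + (`|a * d| + `|b * c|))).
  by rewrite lerD ?ler_normB ?ler_normD.
by rewrite !normrM le_eqVlt; apply/orP; left; apply/eqP; ring.
Qed.

Lemma normc_le_norm1 (z : C) : Normc.normc z <= norm1 z.
Proof.
case: z => a b; rewrite /norm1 /=.
rewrite -[leRHS](ger0_norm (norm1_ge0 (a +i* b))) -sqrtr_sqr ler_wsqrtr//.
rewrite /norm1 /= sqrrD !real_normK ?num_real//.
by rewrite -addrA lerD2l lerDr mulrn_wge0// mulr_ge0.
Qed.

Lemma norm1_le_normc (z : C) : norm1 z <= 2 * Normc.normc z.
Proof.
case: z => a b; rewrite /norm1 /= mulr_natl mulr2n.
rewrite -(sqrtr_sqr a) -(sqrtr_sqr b).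
by rewrite lerD// ler_wsqrtr// ?lerDl ?lerDr sqr_ge0.
Qed.

Lemma ReM (z w : C) : complex.Re (z * w) =
  complex.Re z * complex.Re w - complex.Im z * complex.Im w.
Proof. by case: z; case: w. Qed.

Lemma ImM (z w : C) : complex.Im (z * w) =
  complex.Re z * complex.Im w + complex.Im z * complex.Re w.
Proof. by case: z => a b; case: w => c d. Qed.

Lemma normc_ge_Re (z : C) : complex.Re z <= Normc.normc z.
Proof.
case: z => u v /=; rewrite (le_trans (ler_norm _))// -sqrtr_sqr.
by rewrite ler_wsqrtr// lerDl sqr_ge0.
Qed.

Lemma normc_real (x : R) : Normc.normc x%:C = `|x|.
Proof. by rewrite /= expr0n addr0 sqrtr_sqr. Qed.

Lemma conjcM (z w : C) : conjc (z * w) = conjc z * conjc w.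
Proof. exact: rmorphM. Qed.

Lemma real_complexM (x y : R) : (x * y)%:C = x%:C * y%:C :> C.
Proof. exact: (rmorphM (real_complex R)). Qed.

Lemma expiD (x y : R) : expi (x + y) = expi x * expi y.
Proof.
by apply/eqP; rewrite eq_complex /= cosD sinD eqxx /= addrC.
Qed.

Lemma norm1_expi (x : R) : norm1 (expi x) <= 2.
Proof. by rewrite /norm1 /=; have := cos_max x; have := sin_max x; lra. Qed.

Section OneMeasure.
Context {d : measure_display} {T : measurableType d}.
Implicit Types (mu : {measure set T -> \bar R}) (f g : T -> C).

Lemma Cmeasurable_real (f : T -> R) :
  measurable_fun setT f -> Cmeasurable (fun x => (f x)%:C).
Proof. by move=> mf; split => //=; exact: measurable_cst. Qed.

Lemma Cmeasurable_mul f g :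
  Cmeasurable f -> Cmeasurable g -> Cmeasurable (fun x => f x * g x).
Proof.
move=> [f1 f2] [g1 g2]; split.
  under eq_fun do rewrite ReM.
  by apply: measurable_funB; exact: measurable_funM.
under eq_fun do rewrite ImM.
by apply: measurable_funD; exact: measurable_funM.
Qed.

Lemma Cmeasurable_conj f : Cmeasurable f -> Cmeasurable (fun x => conjc (f x)).
Proof.
move=> [f1 f2]; split.
  by apply: eq_measurable_fun f1 => x _; case: (f x).
apply: (@eq_measurable_fun _ _ _ _ _ (fun x => - complex.Im (f x))).
  by move=> x _; case: (f x).
exact: measurable_funN.
Qed.

Lemma Cmeasurable_expi (h : T -> R) :
  measurable_fun setT h -> Cmeasurable (fun x => expi (h x)).
Proof.
move=> mh; split => /=; apply: measurableT_comp => //.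
  apply: continuous_measurable_fun; exact: continuous_cos.
apply: continuous_measurable_fun; exact: continuous_sin.
Qed.

Lemma Cintegrable_measurable mu f : Cintegrable mu f -> Cmeasurable f.
Proof. by move=> [/measurable_int/measurable_EFinP ? /measurable_int/measurable_EFinP ?]. Qed.

Lemma integrable_norm1 mu f :
  Cintegrable mu f -> mu.-integrable setT (fun x => (norm1 (f x))%:E).
Proof.
move=> [f1 f2].
have := integrableD measurableT (integrable_norm f1) (integrable_norm f2).
by apply: eq_integrable.
Qed.

(** Integrability of products with oscillating factors always goes through this
comparison with a real function. *)
Lemma Cintegrable_dominated mu f (g : T -> R) : Cmeasurable f ->
  mu.-integrable setT (fun x => (g x)%:E) -> (forall x, norm1 (f x) <= g x) ->
  Cintegrable mu f.
Proof.
move=> [f1 f2] ig fg; split; apply: le_integrable ig => //.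
- exact/measurable_EFinP.
- move=> x _; rewrite lee_fin (le_trans _ (ler_norm _))// (le_trans _ (fg x))//.
  by rewrite /norm1 lerDl.
- exact/measurable_EFinP.
- move=> x _; rewrite lee_fin (le_trans _ (ler_norm _))// (le_trans _ (fg x))//.
  by rewrite /norm1 lerDr.
Qed.

Lemma eq_Cintegral mu f g : f =1 g -> Cintegral mu f = Cintegral mu g.
Proof. by move=> /funext ->. Qed.

Lemma Cintegral_norm1_le mu f : Cintegrable mu f ->
  norm1 (Cintegral mu f) <= \int[mu]_x norm1 (f x).
Proof.
move=> [f1 f2]; rewrite /norm1 /= RintegralD//; try exact: integrable_norm.
by rewrite lerD// le_normr_Rintegral.
Qed.

Lemma CintegralZl mu f (c : C) : Cintegrable mu f ->
  Cintegral mu (fun x => c * f x) = c * Cintegral mu f.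
Proof.
move=> [f1 f2]; case: c => a b; rewrite /Cintegral.
have Z (r : R) (h : T -> R) : mu.-integrable setT (EFin \o h) ->
  mu.-integrable setT (EFin \o (fun x => r * h x)).
  by move=> ih; apply: eq_integrable (integrableZl measurableT r ih).
under eq_Rintegral do rewrite ReM /=.
rewrite RintegralB ?RintegralZl//; try exact: Z.
under [in X in _ +i* X]eq_Rintegral do rewrite ImM /=.
by rewrite RintegralD ?RintegralZl//; exact: Z.
Qed.

Lemma CintegrableZl mu f (c : C) : Cintegrable mu f ->
  Cintegrable mu (fun x => c * f x).
Proof.
move=> fi; apply: (@Cintegrable_dominated _ _ (fun x => norm1 c * norm1 (f x))).
- apply: Cmeasurable_mul; last exact: Cintegrable_measurable fi.
  by split; exact: measurable_cst.
- by apply: eq_integrable (integrableZl measurableT (norm1 c) (integrable_norm1 fi)).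
- by move=> x; exact: norm1M.
Qed.

Lemma CintegralD mu f g : Cintegrable mu f -> Cintegrable mu g ->
  Cintegral mu (fun x => f x + g x) = Cintegral mu f + Cintegral mu g.
Proof.
move=> [f1 f2] [g1 g2]; rewrite /Cintegral.
under eq_Rintegral do rewrite raddfD.
rewrite RintegralD//.
under [in X in _ +i* X]eq_Rintegral do rewrite raddfD.
by rewrite RintegralD.
Qed.

End OneMeasure.

Lemma Cmeasurable_comp d1 d2 (T1 : measurableType d1) (T2 : measurableType d2)
  (f : T2 -> C) (g : T1 -> T2) :
  Cmeasurable f -> measurable_fun setT g -> Cmeasurable (fun x => f (g x)).
Proof.
move=> [fr fi] mg; split; [exact: (measurableT_comp fr mg)|].
exact: (measurableT_comp fi mg).
Qed.

Lemma Cintegrable_expi d (T : measurableType d) (m : {measure set T -> \bar R})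
  (h : T -> R) (f : T -> C) : measurable_fun setT h -> Cintegrable m f ->
  Cintegrable m (fun x => expi (h x) * f x).
Proof.
move=> mh fi; apply: (@Cintegrable_dominated _ _ _ _ (fun x => 2 * norm1 (f x))).
- by apply: Cmeasurable_mul; [exact: Cmeasurable_expi|exact: Cintegrable_measurable fi].
- by apply: eq_integrable (integrableZl measurableT 2 (integrable_norm1 fi)).
- by move=> x; rewrite (le_trans (norm1M _ _))// ler_wpM2r ?norm1_ge0// norm1_expi.
Qed.

(** Holds without integrability: when both the positive and the negative part have
infinite integral, the difference is infinite on both sides and truncates
to 0. *)
Lemma RintegralN d (T : measurableType d) (m : {measure set T -> \bar R})
  (f : T -> R) : \int[m]_x (- f x) = - \int[m]_x f x.
Proof.
rewrite /Rintegral [in LHS]integralE [in RHS]integralE.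
have -> : (fun x => (- f x)%:E) = (\- (EFin \o f))%E by [].
rewrite funeposN funenegN.
have := integral_ge0 m (D := setT) (fun x _ => funepos_ge0 (EFin \o f) x).
have := integral_ge0 m (D := setT) (fun x _ => funeneg_ge0 (EFin \o f) x).
case: (integral _ _ _) => [r||] //; case: (integral _ _ _) => [r'||] //= _ _;
  by rewrite ?oppr0 // opprB.
Qed.

Lemma CintegralJ d (T : measurableType d) (m : {measure set T -> \bar R})
  (f : T -> C) : Cintegral m (fun x => conjc (f x)) = conjc (Cintegral m f).
Proof.
rewrite /Cintegral /=; congr (_ +i* _).
  by apply: eq_Rintegral => x _; case: (f x).
by rewrite -RintegralN; apply: eq_Rintegral => x _; case: (f x).
Qed.

Lemma Cintegrable_conj d (T : measurableType d) (m : {measure set T -> \bar R})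
  (f : T -> C) : Cintegrable m f -> Cintegrable m (fun x => conjc (f x)).
Proof.
move=> fi; apply: (@Cintegrable_dominated _ _ _ _ (fun x => norm1 (f x))).
- exact/Cmeasurable_conj/Cintegrable_measurable/fi.
- exact: integrable_norm1.
- by move=> x; case: (f x) => u v; rewrite /norm1 /= normrN.
Qed.

Section TwoMeasures.
Context {d1 d2 : measure_display} {T1 : measurableType d1} {T2 : measurableType d2}.
Variables (m1 : {sigma_finite_measure set T1 -> \bar R})
  (m2 : {sigma_finite_measure set T2 -> \bar R}).

(** Real-valued integrals truncate infinite values to 0, so integrability of
every slice is assumed in order that the inner integrals carry no truncation. *)
Lemma Rintegral_prod12 (f : T1 * T2 -> R) :
  (m1 \x m2)%E.-integrable setT (EFin \o f) ->
  (forall x, m2.-integrable setT (fun y => (f (x, y))%:E)) ->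
  m1.-integrable setT (fun x => (\int[m2]_y f (x, y))%:E) /\
  \int[(m1 \x m2)%E]_z f z = \int[m1]_x \int[m2]_y f (x, y).
Proof.
move=> fi f1; have E x : (\int[m2]_y f (x, y))%:E = fubini_F m2 (EFin \o f) x.
  by rewrite fineK// integrable_fin_num.
split.
  by under eq_fun do rewrite E; exact: integrable_fubini_F.
rewrite /Rintegral -integral12_prod_meas1//; congr fine.
by apply: eq_integral => x _; rewrite -E.
Qed.

Lemma Rintegral_prod21 (f : T1 * T2 -> R) :
  (m1 \x m2)%E.-integrable setT (EFin \o f) ->
  (forall y, m1.-integrable setT (fun x => (f (x, y))%:E)) ->
  m2.-integrable setT (fun y => (\int[m1]_x f (x, y))%:E) /\
  \int[(m1 \x m2)%E]_z f z = \int[m2]_y \int[m1]_x f (x, y).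
Proof.
move=> fi f1; have E x : (\int[m1]_y f (y, x))%:E = fubini_G m1 (EFin \o f) x.
  by rewrite fineK// integrable_fin_num.
split.
  under eq_fun do rewrite E.
  have mf := measurable_int _ fi; apply/integrableP; split.
    apply: measurable_fubini_G; exact: fi.
  apply: le_lt_trans ((integrable21ltyP _ _ mf).1 fi).
  apply: ge0_le_integral => //.
  - by apply: measurableT_comp => //; apply: measurable_fubini_G; exact: fi.
  - apply: (measurable_fun_fubini_tonelli_G (abse \o (EFin \o f))) => //.
      exact: measurableT_comp.
    by move=> z; exact: abse_ge0.
  - by move=> y _; apply: le_abse_integral => //; exact: measurableT_comp.
rewrite /Rintegral -integral21_prod_meas1//; congr fine.
by apply: eq_integral => x _; rewrite -E.
Qed.

Lemma Cintegral_prod12 (f : T1 * T2 -> C) :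
  Cintegrable (m1 \x m2)%E f -> (forall x, Cintegrable m2 (fun y => f (x, y))) ->
  Cintegrable m1 (fun x => Cintegral m2 (fun y => f (x, y))) /\
  Cintegral (m1 \x m2)%E f = Cintegral m1 (fun x => Cintegral m2 (fun y => f (x, y))).
Proof.
move=> [fr fi] f1.
have [r1 r2] := Rintegral_prod12 fr (fun x => (f1 x).1).
have [i1 i2] := Rintegral_prod12 fi (fun x => (f1 x).2).
by split=> //; rewrite /Cintegral r2 i2.
Qed.

Lemma Cintegral_prod21 (f : T1 * T2 -> C) :
  Cintegrable (m1 \x m2)%E f -> (forall y, Cintegrable m1 (fun x => f (x, y))) ->
  Cintegrable m2 (fun y => Cintegral m1 (fun x => f (x, y))) /\
  Cintegral (m1 \x m2)%E f = Cintegral m2 (fun y => Cintegral m1 (fun x => f (x, y))).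
Proof.
move=> [fr fi] f1.
have [r1 r2] := Rintegral_prod21 fr (fun x => (f1 x).1).
have [i1 i2] := Rintegral_prod21 fi (fun x => (f1 x).2).
by split=> //; rewrite /Cintegral r2 i2.
Qed.

(** By Tonelli, the integral of |f| tensor |g| is the product of the integrals. *)
Lemma integrable_tensor (f : T1 -> R) (g : T2 -> R) :
  m1.-integrable setT (EFin \o f) -> m2.-integrable setT (EFin \o g) ->
  (m1 \x m2)%E.-integrable setT (fun z => (f z.1 * g z.2)%:E).
Proof.
move=> fi gi.
have mf : measurable_fun setT f by exact/measurable_EFinP/(measurable_int m1).
have mg : measurable_fun setT g by exact/measurable_EFinP/(measurable_int m2).
apply/integrable12ltyP.
  apply/measurable_EFinP; apply: measurable_funM; exact: measurableT_comp.
under eq_integral => x _.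
  under eq_integral do rewrite /= normrM EFinM.
  rewrite ge0_integralZl//=; last first.
    by apply/measurable_EFinP; exact: measurableT_comp.
  over.
rewrite /=; have /integrableP[_ g1] := gi; have /integrableP[_ f1] := fi.
have g1f : (\int[m2]_y `|g y|%:E)%E \is a fin_num.
  by rewrite ge0_fin_numE// integral_ge0.
rewrite -(fineK g1f) ge0_integralZr//=.
- by rewrite lte_mul_pinfty// ?ge0_fin_numE// ?integral_ge0// ?fineK// ltey_eq g1f.
- by apply/measurable_EFinP; exact: measurableT_comp.
- by rewrite lee_fin fine_ge0// integral_ge0.
Qed.

Lemma Rintegral_tensor (f : T1 -> R) (g : T2 -> R) :
  m1.-integrable setT (EFin \o f) -> m2.-integrable setT (EFin \o g) ->
  \int[(m1 \x m2)%E]_z (f z.1 * g z.2) = \int[m1]_x f x * \int[m2]_y g y.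
Proof.
move=> fi gi.
have [|_ ->] := @Rintegral_prod12 (fun z => f z.1 * g z.2)
    (integrable_tensor fi gi).
  by move=> x /=; apply: eq_integrable (integrableZl measurableT (f x) gi).
rewrite -RintegralZr//; apply: eq_Rintegral => x _ /=.
by rewrite RintegralZl.
Qed.

End TwoMeasures.
End ComplexIntegral.

(** * Affine substitution in Lebesgue integrals *)

Section Affine.
Context {R : realType}.
Local Notation C := (complex R).
Local Notation mu := (@lebesgue_measure R).

Section Substitution.
Variables (a b : R).
Hypothesis a0 : a != 0.
Let phi (x : measurableTypeR R) : measurableTypeR R := a * x + b.
Let mphi : measurable_fun setT phi.
Proof. by apply: measurable_funD => //; exact: measurable_funM. Qed.
Let an := NngNum (normr_ge0 a).
Let image := measure_function_pushforward__canonical__measure_function_Measure mu mphi.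

Let preimage_pos c d : 0 < a -> phi @^-1` `]c, d] = `](c - b) / a, (d - b) / a]%classic.
Proof.
move=> ap; apply/seteqP; split => x /=;
  by rewrite !in_itv /= /phi ltr_pdivrMr// ler_pdivlMr// ltrBlDr lerBrDr (mulrC x).
Qed.

Let preimage_neg c d : a < 0 -> phi @^-1` `]c, d] = `[(d - b) / a, (c - b) / a[%classic.
Proof.
move=> ap; apply/seteqP; split => x /=;
  by rewrite !in_itv /= /phi ltr_ndivlMr// ler_ndivrMr// ltrBlDr lerBrDr (mulrC x) andbC.
Qed.

(** The image of Lebesgue measure under an affine map, scaled by |a|, agrees with
Lebesgue measure on half-open intervals, hence everywhere. *)
Let lebesgue_scaled_image (A : set (measurableTypeR R)) : measurable A ->
  mu A = mscale an image A.
Proof.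
apply: lebesgue_measure_unique => _ [[c d] _ <-] /=.
rewrite /mscale /= /pushforward; have [ap|an'|/eqP] := ltgtP a 0; last first.
- by rewrite (negbTE a0).
- rewrite preimage_pos// (gtr0_norm an') !lebesgue_measure_itv /= !lte_fin.
  rewrite ltr_pM2r ?invr_gt0// ltrD2r.
  case: ifPn => _; last by rewrite mule0.
  by rewrite -!EFinB -EFinM; congr EFin; field.
- rewrite preimage_neg// (ltr0_norm ap) !lebesgue_measure_itv /= !lte_fin.
  rewrite ltr_nM2r ?invr_lt0// ltrD2r.
  case: ifPn => _; last by rewrite mule0.
  by rewrite -!EFinB -EFinM; congr EFin; field.
Qed.

Lemma ge0_integral_affine (f : R -> \bar R) :
  measurable_fun setT f -> (forall x, 0 <= f x)%E ->
  (\int[mu]_x f x = `|a|%:E * \int[mu]_x f (a * x + b)%R)%E.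
Proof.
move=> mf f0.
rewrite (@eq_measure_integral _ _ _ setT (mscale an image)); last first.
  by move=> A mA _; exact: lebesgue_scaled_image.
rewrite ge0_integral_mscale//; congr (_ * _)%E.
by rewrite (@ge0_integral_pushforward _ _ _ _ _ phi mphi mu setT).
Qed.

Lemma integrable_affine (f : R -> R) :
  mu.-integrable setT (EFin \o f) ->
  mu.-integrable setT (fun x => (f (a * x + b))%:E).
Proof.
move=> fi; have mf := measurable_int _ fi.
have mf' : measurable_fun setT (fun x => (EFin \o f) (phi x)).
  exact: (measurableT_comp mf mphi).
apply/integrableP; split=> //.
have /integrableP[_] := fi.
rewrite (@ge0_integral_affine (fun x => `|(f x)%:E|%E)) //; last first.
  exact: measurableT_comp.
have ap : (0 < `|a|) by rewrite normr_gt0.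
move=> h; rewrite ltey; apply: contraTN h => /eqP ->.
by rewrite gt0_muley ?lte_fin.
Qed.

Lemma Rintegral_affine (f : R -> R) :
  mu.-integrable setT (EFin \o f) ->
  \int[mu]_x f (a * x + b) = `|a|^-1 * \int[mu]_x f x.
Proof.
move=> fi; have mf := measurable_int _ fi.
have ap : `|a| != 0 by rewrite normr_eq0.
have ge0 (g : R -> R) : mu.-integrable setT (EFin \o g) -> (forall x, 0 <= g x) ->
    \int[mu]_x g (a * x + b) = `|a|^-1 * \int[mu]_x g x.
  move=> gi g0; apply: (canRL (mulKf ap)) => //.
  rewrite /Rintegral [in RHS](@ge0_integral_affine (EFin \o g)) //; last first.
    exact: measurable_int gi.
  by rewrite fineM// integrable_fin_num// integrable_affine.
(* A signed f is the difference of |f| + f and |f|, both nonnegative. *)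
have ai := integrable_norm fi.
have si : mu.-integrable setT (EFin \o (fun x => `|f x| + f x)).
  by apply: eq_integrable (integrableD measurableT ai fi).
transitivity (\int[mu]_x ((`|f (a * x + b)| + f (a * x + b)) - `|f (a * x + b)|)).
  by apply: eq_Rintegral => x _; ring.
rewrite RintegralB//; last 2 first.
- exact: (integrable_affine si).
- exact: (integrable_affine ai).
rewrite (ge0 (fun x => `|f x| + f x))//; last first.
  by move=> x; have := ler_norm (- f x); rewrite normrN; lra.
rewrite (ge0 (fun x => `|f x|))// RintegralD// -mulrBr.
by congr (_ * _); ring.
Qed.

Lemma Cintegrable_affine (f : R -> C) : Cintegrable mu f ->
  Cintegrable mu (fun x => f (a * x + b)).
Proof.
move=> [fr fi]; split.
  exact: (integrable_affine fr).
exact: (integrable_affine fi).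
Qed.

Lemma Cintegral_affine (f : R -> C) : Cintegrable mu f ->
  Cintegral mu (fun x => f (a * x + b)) = (`|a|^-1)%:C * Cintegral mu f.
Proof.
move=> [fr fi]; rewrite /Cintegral.
rewrite (Rintegral_affine fr) (Rintegral_affine fi).
by apply/eqP; rewrite eq_complex ReM ImM /= !mul0r subr0 addr0 !eqxx.
Qed.
End Substitution.
End Affine.

(** * The Fejer kernel and its Fourier transform *)

Section FejerKernel.
Context {R : realType}.
Local Notation C := (complex R).
Local Notation mu := (@lebesgue_measure R).

Lemma normr_sin_le (x : R) : `|sin x| <= `|x|.
Proof.
wlog x0 : x / 0 <= x.
  move=> h; have [/h//|x0] := leP 0 x.
  by rewrite -normrN -sinN -(normrN x) h// oppr_ge0 ltW.
have [|c _] := @MVT_segment R sin cos 0 x x0 (fun y _ => is_derive_sin y).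
  by apply: continuous_subspaceT => y; exact: continuous_sin.
rewrite sin0 !subr0 => ->; rewrite normrM -[leRHS]mul1r ler_wpM2r//.
exact: cos_max.
Qed.

Lemma oneDsqr_ge0x (x : R) : 0 <= oneDsqr x.
Proof. by rewrite addr_ge0 ?sqr_ge0. Qed.

(** From 1 - cos x = 2 (sin (x / 2))^2. It makes the Fejer kernel bounded at
the origin. *)
Lemma onemcos_le (x : R) : 1 - cos x <= x ^+ 2 / 2.
Proof.
have -> : cos x = 1 - 2 * sin (x / 2) ^+ 2.
  rewrite {1}(_ : x = x / 2 + x / 2) ?cosD; last by field.
  by have := cos2Dsin2 (x / 2); nra.
have := normr_sin_le (x / 2); rewrite -ler_sqr ?nnegrE// !real_normK ?num_real//.
rewrite expr_div_n; lra.
Qed.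

(** The Fejer kernel up to normalization. Division by zero gives the value 0 at
the origin, a null set. *)
Definition fejer0 (x : R) : R := (1 - cos x) / x ^+ 2.

Lemma fejer0_ge0 x : 0 <= fejer0 x.
Proof. by rewrite divr_ge0 ?sqr_ge0// subr_ge0 cos_le1. Qed.

Lemma fejer0_le x : fejer0 x <= 5 / 2 * (oneDsqr x)^-1.
Proof.
have [->|x0] := eqVneq x 0.
  by rewrite /fejer0 cos0 subrr mul0r mulr_ge0// ?invr_ge0 ?oneDsqr_ge0x//; lra.
rewrite /fejer0 /oneDsqr.
have x2 : 0 < x ^+ 2 by rewrite exprn_even_gt0.
rewrite ler_pdivrMr// mulrAC ler_pdivlMr ?addr_gt0//.
have := onemcos_le x; have := cos_geN1 x; nra.
Qed.

(** Real powers are measurable, and the inverse of x^2 is its real power with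
exponent -1, also at 0 where both are 0. *)
Lemma measurable_invsqr : measurable_fun setT (fun x : R => (x ^+ 2)^-1).
Proof.
apply: (@eq_measurable_fun _ _ _ _ _ (fun x : R => (x ^+ 2) `^ (-1))).
  move=> x _; have [->|x0] := eqVneq x 0.
    by rewrite expr0n /= powR0// invr0.
  by rewrite powR_inv1// sqr_ge0.
by apply: (measurableT_comp (measurable_powR (-1))); exact: measurable_funX.
Qed.

Lemma measurable_fejer0 : measurable_fun setT fejer0.
Proof.
apply: measurable_funM; last exact: measurable_invsqr.
apply: measurable_funB => //.
by apply: continuous_measurable_fun; exact: continuous_cos.
Qed.

Lemma integrable_oneDsqrV :
  mu.-integrable setT (fun x => ((oneDsqr x)^-1)%:E).
Proof.
apply/integrableP; split.
  apply/measurable_EFinP; apply: continuous_measurable_fun.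
  exact: continuous_oneDsqrV.
under eq_integral do rewrite gee0_abs ?lee_fin ?invr_ge0 ?oneDsqr_ge0x//.
rewrite (@ge0_symfun_integralT _ (fun x => (oneDsqr x)^-1)).
- have -> : [set x : R | 0 <= x] = `[0, +oo[%classic by rewrite set_itvcy.
  by rewrite integral0y_oneDsqr -EFinM ltry.
- by move=> x; rewrite invr_ge0 oneDsqr_ge0x.
- exact: continuous_oneDsqrV.
- by move=> x; rewrite /oneDsqr /= sqrrN.
Qed.

Lemma integrable_fejer0 : mu.-integrable setT (EFin \o fejer0).
Proof.
apply: le_integrable (integrableZl measurableT (5 / 2) integrable_oneDsqrV) => //.
  by apply/measurable_EFinP; exact: measurable_fejer0.
move=> x _; rewrite /= lee_fin !ger0_norm ?fejer0_ge0 ?fejer0_le//.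
Qed.

Definition fejer_mass : R := \int[mu]_x fejer0 x.

(** On [1, 2] the kernel is at least (1 - cos 1) / 4, since cos decreases there. *)
Lemma fejer_mass_gt0 : 0 < fejer_mass.
Proof.
(* The denominator 4 is the largest value of x^2 on [1, 2]. *)
pose c := (1 - cos 1) / 4 : R.
have pi2 : (2 : R) <= pi := pi_ge2 R.
have c0 : 0 < c.
  rewrite divr_gt0// subr_gt0 -[ltRHS]cos0 ltr_cos ?in_itv //=; apply/andP; split; lra.
have ci := integrableZl measurableT c (@integrable_indic_itv R 1 2 true false).
have E : \int[mu]_x (c * \1_`[1, 2] x) = c.
  rewrite RintegralZl//; last exact: integrable_indic_itv.
  rewrite /Rintegral integral_indic// setIT.
  have m12 := lebesgue_measure_itv `[1%R : R, 2]; rewrite /= lte_fin ltr1n -EFinB in m12.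
  by rewrite -[RHS]mulr1; congr (_ * _); rewrite [LHS](congr1 fine m12) /=; lra.
rewrite (lt_le_trans c0)// -[leLHS]E /fejer_mass; apply: le_Rintegral => //.
  exact: integrable_fejer0.
move=> x _; rewrite indicE; have [|_] := boolP (x \in _); last first.
  by rewrite mulr0 fejer0_ge0.
rewrite inE /= in_itv /= mulr1 => /andP[x1 x2].
rewrite /fejer0 ler_pdivlMr ?exprn_gt0//; last lra.
have cx : cos x <= cos 1.
  by rewrite leNgt ltr_cos ?in_itv /= -?leNgt //; apply/andP; split; lra.
have x4 : x ^+ 2 <= 4 by nra.
have := ler_wpM2l (ltW c0) x4; rewrite {2}/c; lra.
Qed.

(** The substitution y = a x: the integrand is a^2 times the kernel at a x, and
the change of variable costs 1 / |a|. *)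
Lemma dilated_fejer0 (a : R) :
  mu.-integrable setT (fun x => ((1 - cos (a * x)) / x ^+ 2)%:E) /\
  \int[mu]_x ((1 - cos (a * x)) / x ^+ 2) = `|a| * fejer_mass.
Proof.
have [->|a0] := eqVneq a 0.
  rewrite normr0 mul0r.
  split.
    apply: eq_integrable (integrable0 mu setT) => // x _.
    by rewrite mul0r cos0 subrr mul0r.
  by under eq_Rintegral do rewrite mul0r cos0 subrr mul0r; rewrite Rintegral_cst// mul0r.
have E x : (1 - cos (a * x)) / x ^+ 2 = a ^+ 2 * fejer0 (a * x + 0).
  rewrite addr0 /fejer0; have [->|x0] := eqVneq x 0.
    by rewrite mulr0 cos0 subrr !mul0r mulr0.
  by field; rewrite ?a0 ?x0.
under eq_fun do rewrite E.
have fi := integrable_affine 0 a0 integrable_fejer0.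
split.
  by apply: eq_integrable (integrableZl measurableT (a ^+ 2) fi).
under eq_Rintegral do rewrite E.
rewrite RintegralZl// (Rintegral_affine 0 a0 integrable_fejer0) mulrA.
by congr (_ * _); rewrite -real_normK ?num_real// expr2 mulfK// normr_eq0.
Qed.

Definition tent (x : R) : R := Num.max 0 (1 - `|x|).

Definition fejer (x : R) : R := fejer_mass^-1 * fejer0 x.

Lemma fejer_ge0 x : 0 <= fejer x.
Proof. by rewrite mulr_ge0 ?fejer0_ge0// invr_ge0 ltW// fejer_mass_gt0. Qed.

Lemma measurable_fejer : measurable_fun setT fejer.
Proof. by apply: measurable_funM => //; exact: measurable_fejer0. Qed.

Lemma integrable_fejer : mu.-integrable setT (EFin \o fejer).
Proof.
by apply: eq_integrable (integrableZl measurableT fejer_mass^-1 integrable_fejer0).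
Qed.

Lemma Cintegrable_fejer xi :
  Cintegrable mu (fun x => expi (- (x * xi)) * (fejer x)%:C).
Proof.
apply: (@Cintegrable_dominated R _ _ mu _ (fun x => 2 * fejer x)).
- apply: Cmeasurable_mul.
    apply: Cmeasurable_expi; apply: measurableT_comp => //.
    exact: measurable_funM.
  by apply: Cmeasurable_real; exact: measurable_fejer.
- by apply: eq_integrable (integrableZl measurableT 2 integrable_fejer).
- move=> x; rewrite (le_trans (norm1M _ _))//.
  apply: ler_pM; rewrite ?norm1_ge0// /norm1 /=.
    by have := cos_max (- (x * xi)); have := sin_max (- (x * xi)); lra.
  by rewrite normr0 addr0 ger0_norm ?fejer_ge0.
Qed.

Lemma tentE (x : R) : `|1 + x| / 2 + `|1 - x| / 2 - `|x| = tent x.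
Proof.
rewrite /tent maxEle; case: (ger0P (1 + x)) => ?; case: (ger0P (1 - x)) => ?;
  case: (ger0P x) => ?; case: ifPn; rewrite -?ltNge => ?; lra.
Qed.

(** The imaginary part vanishes by parity. For the real part,
(1 - cos x) cos (xi x) is half of (1 - cos ((1 + xi) x)) plus half of
(1 - cos ((1 - xi) x)) minus (1 - cos (xi x)); each term integrates against
1 / x^2 by the scaling law, and [tentE] recognizes the result. *)
Lemma fourier_fejer xi :
  Cintegral mu (fun x => expi (- (x * xi)) * (fejer x)%:C) = (tent xi)%:C.
Proof.
have [ir ii] := Cintegrable_fejer xi.
rewrite /Cintegral; congr (_ +i* _).
  have [i1 e1] := dilated_fejer0 (1 + xi).
  have [i2 e2] := dilated_fejer0 (1 - xi).
  have [i3 e3] := dilated_fejer0 xi.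
  have Z (r : R) (h : R -> R) : mu.-integrable setT (EFin \o h) ->
      mu.-integrable setT (EFin \o (fun x => r * h x)).
    by move=> ih; apply: eq_integrable (integrableZl measurableT r ih).
  transitivity (\int[mu]_x (fejer_mass^-1 / 2 * ((1 - cos ((1 + xi) * x)) / x ^+ 2) +
     fejer_mass^-1 / 2 * ((1 - cos ((1 - xi) * x)) / x ^+ 2) -
     fejer_mass^-1 * ((1 - cos (xi * x)) / x ^+ 2))).
    apply: eq_Rintegral => x _; rewrite ReM /= mulr0 subr0 cosN /fejer /fejer0.
    have -> : (1 + xi) * x = x + xi * x by ring.
    have -> : (1 - xi) * x = x - xi * x by ring.
    rewrite cosD cosB (mulrC x xi).
    (* The inverse square is kept as an atom, being 0 and not undefined at 0. *)
    set y := (x ^+ 2)^-1; set M := fejer_mass^-1; lra.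
  rewrite RintegralB//; last 2 first.
  - by apply: eq_integrable (integrableD measurableT (Z _ _ i1) (Z _ _ i2)).
  - exact: Z.
  rewrite RintegralD ?RintegralZl ?e1 ?e2 ?e3 -?tentE//; try exact: Z.
  by field; rewrite gt_eqF// fejer_mass_gt0.
(* The substitution x -> - x shows that the integral equals its opposite. *)
have odd : \int[mu]_x complex.Im (expi (- (x * xi)) * (fejer x)%:C) =
    - \int[mu]_x complex.Im (expi (- (x * xi)) * (fejer x)%:C).
  have N1 : (-1 : R) != 0 by rewrite oppr_eq0 oner_eq0.
  have := Rintegral_affine 0 N1 ii; rewrite normrN1 invr1 mul1r => {1}<-.
  rewrite -[RHS]mulN1r -RintegralZl//; apply: eq_Rintegral => x _.
  rewrite !ImM /= !mulr0 !add0r addr0 !mulN1r.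
  have -> : - (- x * xi) = x * xi by ring.
  by rewrite sinN /fejer /fejer0 cosN sqrrN; ring.
lra.
Qed.

End FejerKernel.

(** * Distributions with an integrable density *)

Section PlaneMeasurability.
Context {R : realType}.
Local Notation plane := (measurableTypeR R * measurableTypeR R)%type.

(** The Borel sets of the plane are generated by rectangles: an open set is the
countable union of the squares with rational centres and radii 1 / (k + 1) that
it contains. *)
Lemma open_plane_measurable (U : set (R * R)) :
  open U -> measurable (U : set plane).
Proof.
move=> oU.
pose B (r : rat * rat * nat) : set plane :=
  ball (ratr r.1.1 : R) r.2.+1%:R^-1 `*` ball (ratr r.1.2 : R) r.2.+1%:R^-1.
have -> : (U : set plane) = \bigcup_r (if `[< B r `<=` U >] then B r else set0).
  apply/seteqP; split; last by move=> p [r _]; case: asboolP => // BU; exact: BU.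
  move=> [x t] Up; have /nbhs_ballP[e /= e0 eU] := open_nbhs_nbhs (conj oU Up).
  (* The square has side below e, so it stays in the ball although its centre is
   moved by up to 1 / (n + 1). *)
  have [n _ /(_ n (leqnn n))] := near_infty_natSinv_lt (PosNum (divr_gt0 e0 (ltr0n _ 2))).
  rewrite /=; set d := n.+1%:R^-1 => dn.
  have d0 : 0 < d by rewrite invr_gt0.
  have approx (y : R) : exists a : rat, `|ratr a - y| < d.
    have [|a] := @rat_in_itvoo R (y - d) (y + d); first lra.
    by rewrite in_itv /= => /andP[? ?]; exists a; rewrite ltr_norml; lra.
  have [[a xa] [b tb]] := (approx x, approx t).
  exists (a, b, n) => //; case: asboolP => [_|[]]; first by split.
  move=> [y z] [/= ya zb]; apply: eU; split; rewrite /ball /= in ya zb *.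
    rewrite (_ : x - y = (ratr a - y) - (ratr a - x)); last by ring.
    by rewrite (le_lt_trans (ler_normB _ _))//; rewrite -/d in ya; lra.
  rewrite (_ : t - z = (ratr b - z) - (ratr b - t)); last by ring.
  by rewrite (le_lt_trans (ler_normB _ _))//; rewrite -/d in zb; lra.
apply: countable_bigcupT_measurable; first exact: countableP.
move=> r; case: ifP => // _.
by apply: measurableX; exact: measurable_ball.
Qed.

Lemma continuous_plane_measurable (f : R * R -> R) :
  continuous f -> measurable_fun (setT : set plane) f.
Proof.
move=> /continuousP cf; apply: (measurability _ (RGenOpens.measurableE R)).
move=> _ [_ [a [b ->] <-]]; rewrite setTI; apply: open_plane_measurable.
exact/cf/interval_open.
Qed.

End PlaneMeasurability.

Section Schwartz.
Context {R : realType}.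
Local Notation C := (complex R).
Local Notation normC := (@Normc.normc R).
Local Notation plane := (measurableTypeR R * measurableTypeR R)%type.
Variable f : R * R -> C.
Hypothesis sf : schwartz f.

Lemma schwartz_measurable : Cmeasurable (f : plane -> C).
Proof.
have [sm _] := sf; split; apply: continuous_plane_measurable => p.
  by have [/differentiable_continuous] := sm 0 0 p.
by have [_ /differentiable_continuous] := sm 0 0 p.
Qed.

Lemma schwartz_seminorm_fin i j : seminorm i j 0 0 f \is a fin_num.
Proof.
have [_ /(_ i j 0 0) lty] := sf; rewrite fin_numElt lty andbT.
apply: lt_le_trans (ereal_sup_ubound _); last by exists (0, 0).
by rewrite ltNyr.
Qed.

Lemma schwartz_bound i j (p : R * R) :
  normC (f p) * (`|p.1| ^+ i * `|p.2| ^+ j) <= fine (seminorm i j 0 0 f).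
Proof.
rewrite -lee_fin fineK ?schwartz_seminorm_fin//.
by apply: ereal_sup_ubound; exists p.
Qed.

(** The four seminorms with weights 1, x^2, t^2 and x^2 t^2 add up to a bound of
|f| (1 + x^2) (1 + t^2). *)
Lemma schwartz_integrable : Cintegrable leb2 f.
Proof.
pose S i j := fine (seminorm i j 0 0 f).
pose K := 2 * (S 0%N 0%N + S 2%N 0%N + S 0%N 2%N + S 2%N 2%N).
have i1 := @integrable_oneDsqrV R.
apply: (@Cintegrable_dominated _ _ _ _ _
  (fun p : plane => K * ((oneDsqr p.1)^-1 * (oneDsqr p.2)^-1))).
- exact: schwartz_measurable.
- by apply: eq_integrable (integrableZl measurableT K (integrable_tensor i1 i1)).
- move=> p; apply: le_trans (norm1_le_normc _) _.
  rewrite /K -mulrA ler_wpM2l// -invfM ler_pdivlMr ?mulr_gt0//.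
  have := schwartz_bound 0%N 0%N p; have := schwartz_bound 2%N 0%N p.
  have := schwartz_bound 0%N 2%N p; have := schwartz_bound 2%N 2%N p.
  rewrite -/(S 0%N 0%N) -/(S 2%N 0%N) -/(S 0%N 2%N) -/(S 2%N 2%N) !expr0 !real_normK ?num_real//.
  rewrite /oneDsqr; nra.
Qed.

End Schwartz.

Section Density.
Context {R : realType}.
Local Notation C := (complex R).
Local Notation plane := (measurableTypeR R * measurableTypeR R)%type.

Definition density (G : R * R -> C) : functional := fun g =>
  Cintegral leb2 (fun p => G p * g p).

Variable G : R * R -> C.
Hypothesis iG : Cintegrable leb2 G.

Lemma density_integrable (g : R * R -> C) (M : R) :
  Cmeasurable (g : plane -> C) -> (forall p, norm1 (g p) <= M) ->
  Cintegrable leb2 (fun p => G p * g p).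
Proof.
move=> mg gM.
apply: (@Cintegrable_dominated _ _ _ _ _ (fun p : plane => M * norm1 (G p))).
- by apply: Cmeasurable_mul => //; exact: Cintegrable_measurable iG.
- by apply: eq_integrable (integrableZl measurableT M (integrable_norm1 iG)).
- by move=> p; rewrite (le_trans (norm1M _ _))// mulrC ler_wpM2r ?norm1_ge0//.
Qed.

Lemma schwartz_norm1_le (g : R * R -> C) p : schwartz g ->
  norm1 (g p) <= 2 * fine (seminorm 0 0 0 0 g).
Proof.
move=> sg; apply: le_trans (norm1_le_normc _) _; rewrite ler_wpM2l//.
by have := schwartz_bound sg 0%N 0%N p; rewrite !expr0 !mulr1.
Qed.

Lemma density_schwartz (g : R * R -> C) : schwartz g ->
  Cintegrable leb2 (fun p => G p * g p).
Proof.
move=> sg; apply: density_integrable (fun p => schwartz_norm1_le p sg).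
exact: schwartz_measurable.
Qed.

Lemma density_tempered : tempered (density G).
Proof.
split.
  move=> a f g sf sg; rewrite /density -CintegralZl; last exact: density_schwartz.
  rewrite -CintegralD; last 2 first.
  - exact/CintegrableZl/density_schwartz.
  - exact: density_schwartz.
  by apply: eq_Cintegral => p; rewrite mulrDr mulrCA.
(* The bound is by the supremum of |f|; the factor 2 compares norm1 with the
   modulus. *)
exists (2 * \int[leb2]_p norm1 (G p)), 1%N => f sf.
rewrite !big_ord1 -(fineK (schwartz_seminorm_fin sf 0 0)) -EFinM lee_fin.
have iGf := density_schwartz sf.
have iN := integrable_norm1 iG.
apply: le_trans (normc_le_norm1 _) _; apply: le_trans (Cintegral_norm1_le iGf) _.
rewrite mulrAC -RintegralZl//; apply: le_Rintegral => //.
- exact: integrable_norm1 iGf.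
- by apply: eq_integrable (integrableZl measurableT _ iN).
- move=> p _; apply: le_trans (norm1M _ _) _; rewrite mulrC ler_wpM2r ?norm1_ge0//.
  exact: schwartz_norm1_le.
Qed.

Lemma measurable_fun_dot (q : R * R) :
  measurable_fun (setT : set plane) (fun p => - (p.1 * q.1 + p.2 * q.2)).
Proof.
apply: measurableT_comp => //; apply: measurable_funD.
  by apply: measurable_funM => //; exact: measurable_fst.
by apply: measurable_funM => //; exact: measurable_snd.
Qed.

(** Both sides are the integral of G(p) exp(- i p.q) f(q) over all p and q,
taken in the two orders. *)
Lemma fourier_multiplication (f : R * R -> C) : Cintegrable leb2 f ->
  Cintegrable leb2 (fun p => fourier G p * f p) /\
  density G (fourier f) = Cintegral leb2 (fun p => fourier G p * f p).
Proof.
move=> If.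
pose h (z : plane * plane) : C :=
  expi (- (z.1.1 * z.2.1 + z.1.2 * z.2.2)) * (G z.1 * f z.2).
have hGE p q : h (p, q) = G p * (expi (- (q.1 * p.1 + q.2 * p.2)) * f q).
  by rewrite /h /= mulrCA (mulrC q.1) (mulrC q.2).
have hfE p q : h (p, q) = f q * (expi (- (p.1 * q.1 + p.2 * q.2)) * G p).
  by rewrite /h /= mulrA mulrC.
have hi : Cintegrable (leb2 \x leb2)%E h.
  apply: Cintegrable_expi.
    apply: measurableT_comp => //; apply: measurable_funD; apply: measurable_funM;
      exact: measurableT_comp.
  apply: (@Cintegrable_dominated _ _ _ _ _
    (fun z : plane * plane => norm1 (G z.1) * norm1 (f z.2))).
  - apply: Cmeasurable_mul.
      exact: (Cmeasurable_comp (Cintegrable_measurable iG) measurable_fst).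
    exact: (Cmeasurable_comp (Cintegrable_measurable If) measurable_snd).
  - exact: (integrable_tensor (integrable_norm1 iG) (integrable_norm1 If)).
  - by move=> z; exact: norm1M.
have h1 p : Cintegrable leb2 (fun q => h (p, q)).
  under eq_fun do rewrite hGE; apply: CintegrableZl.
  by apply: Cintegrable_expi If; exact: measurable_fun_dot.
have h2 q : Cintegrable leb2 (fun p => h (p, q)).
  under eq_fun do rewrite hfE; apply: CintegrableZl.
  by apply: Cintegrable_expi iG; exact: measurable_fun_dot.
have E1 p : Cintegral leb2 (fun q => h (p, q)) = G p * fourier f p.
  rewrite -CintegralZl; first by apply: eq_Cintegral => q; exact: hGE.
  by apply: Cintegrable_expi If; exact: measurable_fun_dot.
have E2 q : Cintegral leb2 (fun p => h (p, q)) = fourier G q * f q.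
  rewrite mulrC -CintegralZl; first by apply: eq_Cintegral => p; exact: hfE.
  by apply: Cintegrable_expi iG; exact: measurable_fun_dot.
have [_ e1] := Cintegral_prod12 hi h1.
have [i2 e2] := Cintegral_prod21 hi h2.
split; first by under eq_fun do rewrite -E2.
transitivity (Cintegral (leb2 \x leb2)%E h).
  by rewrite e1; apply: eq_Cintegral => p; rewrite E1.
by rewrite e2; apply: eq_Cintegral => q; rewrite E2.
Qed.

Lemma density_has_fourier : Cmeasurable (fourier G : plane -> C) ->
  has_fourier (density G) (fourier G).
Proof.
move=> mG; split=> // f sf.
exact: fourier_multiplication (schwartz_integrable sf).
Qed.

End Density.

(** * Wave packets *)

Section Conj.
Context {R : realType}.
Local Notation C := (complex R).

(** The conjugate of a density is the density of the conjugate; for the transform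
this means conjugation and reflection through the origin
([fourier_conj]). *)
Lemma dconj_density (G : R * R -> C) :
  dconj (density G) = density (fun p => conjc (G p)).
Proof.
apply/funext => g; rewrite /dconj /density -CintegralJ.
by apply: eq_Cintegral => p; rewrite conjcM conjcK.
Qed.

Lemma fourier_conj (G : R * R -> C) (q : R * R) :
  fourier (fun p => conjc (G p)) q = conjc (fourier G (- q)).
Proof.
rewrite /fourier -CintegralJ; apply: eq_Cintegral => p.
rewrite conjcM; congr (_ * _); rewrite /expi /= !mulrN -opprD opprK.
by rewrite cosN sinN.
Qed.

End Conj.

Section Packet.
Context {R : realType}.
Local Notation C := (complex R).
Local Notation mu := (@lebesgue_measure R).
Local Notation plane := (measurableTypeR R * measurableTypeR R)%type.

(** Tonelli, integrating first along the direction in which the shear acts by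
translations. *)
Lemma integrable_shear (a b : R) (f g : R -> R) : a != 0 ->
  mu.-integrable setT (EFin \o f) -> mu.-integrable setT (EFin \o g) ->
  leb2.-integrable setT (fun p => (f (a * p.1 + b * p.2) * g p.2)%:E).
Proof.
move=> a0 fi gi.
have mf : measurable_fun setT f by apply/measurable_EFinP; exact: measurable_int fi.
have mg : measurable_fun setT g by apply/measurable_EFinP; exact: measurable_int gi.
have shear : measurable_fun (setT : set plane) (fun p => a * p.1 + b * p.2 : measurableTypeR R).
  by apply: measurable_funD; apply: measurable_funM => //.
apply/integrable21ltyP.
  apply/measurable_EFinP; apply: measurable_funM.
    exact: (measurableT_comp mf shear).
  exact: (measurableT_comp mg measurable_snd).
pose I := fine (\int[mu]_x `|f x|%:E)%E.
have fai := integrable_norm fi; have gai := integrable_norm gi.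
have inner t : (\int[mu]_x `|(f (a * x + b * t) * g t)%:E| = (`|a|^-1 * I * `|g t|)%:E)%E.
  under eq_integral do rewrite abse_EFin normrM.
  have fti := integrable_affine (b * t) a0 fai.
  rewrite -[LHS]fineK; last first.
    by apply: integrable_fin_num => //; apply: eq_integrable (integrableZr measurableT `|g t| fti).
  congr EFin; rewrite -[LHS]/(Rintegral _ _ _) RintegralZr//.
  by rewrite (Rintegral_affine (b * t) a0 fai).
under eq_integral => t _ do rewrite inner.
apply: integrable_lty => //.
by apply: eq_integrable (integrableZl measurableT (`|a|^-1 * I) gai).
Qed.

Variables (a m xi0 tau0 : R).
Hypothesis a0 : 0 < a.

(** The factor exp(i (x xi0 + t tau0)) moves the transform to (xi0, tau0), the
dilation by a sets its width in xi, and the shear x + m t in physical space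
becomes the slope m of the parallelogram in frequency space. *)
Definition packet (p : R * R) : C :=
  expi (p.1 * xi0 + p.2 * tau0) * (a * (fejer (a * p.1 + a * m * p.2) * fejer p.2))%:C.

(** The transform of the packet; its support is a parallelogram of half-width a
and half-height 1 along the line through (xi0, tau0) of slope m. *)
Definition tent_box (q : R * R) : R :=
  tent ((q.1 - xi0) / a) * tent (q.2 - tau0 - m * (q.1 - xi0)).

Lemma packet_integrable : Cintegrable leb2 packet.
Proof.
have fi := @integrable_fejer R.
have := integrableZl measurableT a (integrable_shear (a * m) (lt0r_neq0 a0) fi fi).
move=> ri; apply: Cintegrable_expi.
  by apply: measurable_funD; apply: measurable_funM => //.
split=> //; exact: integrable0.
Qed.

(** Integrating first in x, the substitution y = a (x + m t) gives a tent in xi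
and leaves the phase exp(i m t (xi - xi0)), which the integral in t turns into the
shear of the second tent. *)
Lemma fourier_packet (q : R * R) : fourier packet q = (tent_box q)%:C.
Proof.
pose h (p : plane) : C := expi (- (p.1 * q.1 + p.2 * q.2)) * packet p.
pose eta := (q.1 - xi0) / a.
pose sigma := q.2 - tau0 - m * (q.1 - xi0).
pose k y : C := expi (- (y * eta)) * (fejer y)%:C.
have hE x t : h (x, t) = (a * fejer t)%:C * expi (- (t * sigma)) * k (a * x + a * m * t).
  rewrite /h /packet /k /= mulrA -expiD.
  have -> : - (x * q.1 + t * q.2) + (x * xi0 + t * tau0) =
      - (t * sigma) + - ((a * x + a * m * t) * eta).
    by rewrite /sigma /eta; field; rewrite gt_eqF.
  by rewrite expiD !real_complexM; ring.
have ki := Cintegrable_fejer eta.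
have hi t : Cintegrable mu (fun x => h (x, t)).
  under eq_fun do rewrite hE; apply: CintegrableZl.
  exact: (Cintegrable_affine (a * m * t) (lt0r_neq0 a0) ki).
have [_ e] := @Cintegral_prod21 _ _ _ _ _ mu mu h
  (Cintegrable_expi (measurable_fun_dot q) packet_integrable) hi.
transitivity (Cintegral mu (fun t => (tent eta)%:C * (expi (- (t * sigma)) * (fejer t)%:C))).
  rewrite /fourier [LHS]e; apply: eq_Cintegral => t.
  under eq_Cintegral do rewrite hE.
  rewrite CintegralZl; last exact: (Cintegrable_affine (a * m * t) (lt0r_neq0 a0) ki).
  rewrite (Cintegral_affine (a * m * t) (lt0r_neq0 a0) ki) fourier_fejer gtr0_norm//.
  rewrite !real_complexM -[RHS]mul1r -(_ : a%:C * (a^-1)%:C = 1); first by ring.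
  by rewrite -real_complexM divff// gt_eqF.
rewrite CintegralZl; last exact: Cintegrable_fejer.
by rewrite fourier_fejer -real_complexM.
Qed.

Lemma packet_has_fourier : Cmeasurable (fun q : plane => (tent_box q)%:C) ->
  has_fourier (density packet) (fun q => (tent_box q)%:C).
Proof.
by rewrite -(funext fourier_packet); exact: density_has_fourier packet_integrable.
Qed.

Lemma packet_dconj_has_fourier :
  Cmeasurable (fun q : plane => (tent_box (- q))%:C) ->
  has_fourier (dconj (density packet)) (fun q => (tent_box (- q))%:C).
Proof.
have <- : fourier (fun p => conjc (packet p)) = (fun q => (tent_box (- q))%:C).
  apply/funext => q; rewrite fourier_conj fourier_packet.
  by apply/eqP; rewrite eq_complex /= oppr0 !eqxx.
rewrite dconj_density; apply: density_has_fourier.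
exact: Cintegrable_conj packet_integrable.
Qed.
End Packet.

(** * Square norms of cutoffs *)

Section Monotone.
Context {R : realType}.
Local Notation mu := (@lebesgue_measure R).

(** The integral of a nonnegative function is a supremum over the simple functions
below it, so it is monotone for all functions. This spares the measurability in
xi of the inner norms. *)
Lemma ge0_le_integral_any d (T : measurableType d) (m : {measure set T -> \bar R})
  (f g : T -> \bar R) : (forall x, 0 <= f x)%E -> (forall x, f x <= g x)%E ->
  (\int[m]_x f x <= \int[m]_x g x)%E.
Proof.
move=> f0 fg; rewrite !ge0_integralTE//; last first.
  by move=> x; exact: le_trans (f0 x) (fg x).
apply: le_ereal_sup => _ [h hf <-]; exists h => // x.
exact: le_trans (hf x) (fg x).
Qed.

Lemma le_Lnorm2 (f g : R -> \bar R) : (forall x, 0 <= f x)%E ->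
  (forall x, f x <= g x)%E -> (Lnorm mu 2%:E f <= Lnorm mu 2%:E g)%E.
Proof.
move=> f0 fg; rewrite unlock; apply: gt0_ler_poweR.
- by rewrite invr_ge0.
- by rewrite in_itv /= leey andbT integral_ge0// => x _; exact: poweR_ge0.
- by rewrite in_itv /= leey andbT integral_ge0// => x _; exact: poweR_ge0.
apply: ge0_le_integral_any => x; first exact: poweR_ge0.
have g0 := le_trans (f0 x) (fg x).
by apply: gt0_ler_poweR; rewrite ?in_itv /= ?leey ?abse_ge0 ?andbT ?gee0_abs//.
Qed.

(** Real-valued, so that products of cutoffs represent conjunctions. *)
Definition cutoff (r x : R) : R := (`|x| <= r)%R%:R.

Lemma cutoff_ge0 r x : 0 <= cutoff r x. Proof. exact: ler0n. Qed.

Lemma cutoff_indic (r c : R) :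
  (fun x => cutoff r (x - c)) = \1_(`[c - r, c + r]%classic : set (measurableTypeR R)).
Proof.
apply/funext => x; rewrite indicE /cutoff; congr (_ %:R).
congr (nat_of_bool _); rewrite ler_distl; apply/idP/idP.
  by move=> h; rewrite inE /= in_itv.
by rewrite inE /= in_itv.
Qed.

Lemma integrable_cutoff (r c : R) :
  mu.-integrable setT (EFin \o (fun x => cutoff r (x - c))).
Proof. by rewrite cutoff_indic; exact: integrable_indic_itv. Qed.

Lemma integral_cutoff (r c : R) : 0 <= r ->
  (\int[mu]_x (cutoff r (x - c))%:E = (2 * r)%:E)%E.
Proof.
move=> r0; have -> : (fun x => (cutoff r (x - c))%:E) =
   (fun x => (\1_(`[c - r, c + r]%classic : set (measurableTypeR R)) x)%:E).
  by rewrite -cutoff_indic.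
rewrite integral_indic// setIT [LHS](lebesgue_measure_itv `[c - r, c + r]) /= lte_fin.
case: ifPn => [_|]; first by rewrite -EFinB; congr EFin; ring.
by rewrite -leNgt => h; congr EFin; lra.
Qed.

Lemma Lnorm2_cutoff (k r c : R) : 0 <= k -> 0 <= r ->
  Lnorm mu 2%:E (fun x => (k * cutoff r (x - c))%:E) = (k * Num.sqrt (2 * r))%:E.
Proof.
move=> k0 r0; rewrite unlock.
have E x : (`|(k * cutoff r (x - c))%:E| `^ 2 = (k ^+ 2 * cutoff r (x - c))%:E)%E.
  rewrite gee0_abs ?lee_fin ?mulr_ge0 ?cutoff_ge0// poweR_EFin.
  rewrite powR_mulrn ?mulr_ge0 ?cutoff_ge0// exprMn; congr EFin; congr (_ * _).
  by rewrite /cutoff; case: (`|_| <= _); rewrite ?expr1n ?expr0n.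
under eq_integral do rewrite E.
under eq_integral do rewrite EFinM.
rewrite integralZl//; last exact: integrable_cutoff.
rewrite integral_cutoff// -EFinM poweR_EFin powR12_sqrt; last first.
  by rewrite !mulr_ge0 ?sqr_ge0.
by rewrite sqrtrM ?sqr_ge0// sqrtr_sqr ger0_norm.
Qed.

End Monotone.

(** * Tents on a parallelogram and their convolution *)

Section Tent.
Context {R : realType}.

Lemma tent_ge0 (x : R) : 0 <= tent x.
Proof. by rewrite /tent le_max lexx. Qed.

Lemma tent_le_cutoff (x : R) : tent x <= cutoff 1 x.
Proof.
rewrite /tent /cutoff ge_max ler0n /=.
by have [_|?] := boolP (`|x| <= 1); rewrite /= ?mulr0n; have := normr_ge0 x; lra.
Qed.

Lemma tent_ge (r x : R) : `|x| <= r -> 1 - r <= tent x.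
Proof. by move=> xr; rewrite /tent le_max; apply/orP; right; lra. Qed.

Lemma measurable_tent : measurable_fun setT (@tent R).
Proof.
apply: measurable_maxr => //; apply: measurable_funB => //.
Qed.

Lemma measurable_cutoff (r : R) : measurable_fun setT (cutoff r).
Proof.
have -> : cutoff r = (fun x => cutoff r (x - 0)) by apply/funext => x; rewrite subr0.
by apply/measurable_EFinP; exact: measurable_int (integrable_cutoff r 0).
Qed.

End Tent.

Section Box.
Context {R : realType}.
Local Notation C := (complex R).
Local Notation mu := (@lebesgue_measure R).
Local Notation plane := (measurableTypeR R * measurableTypeR R)%type.
Variables (a m xi0 tau0 : R).
Hypothesis a0 : 0 < a.
Local Notation F := (tent_box a m xi0 tau0).

Definition box (r : R) (q : R * R) : bool :=
  (`|q.1 - xi0| <= r * a) && (`|q.2 - (tau0 + m * (q.1 - xi0))| <= r).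

Lemma boxE r q : (box r q)%:R =
  cutoff (r * a) (q.1 - xi0) * cutoff r (q.2 - (tau0 + m * (q.1 - xi0))).
Proof. by rewrite /cutoff -natrM mulnb. Qed.

(** A parallelogram has vertical sections of the same length 2 r, so that the shear
does not affect the iterated norm. *)
Lemma Lnorm2_box (k r : R) : 0 <= k -> 0 <= r ->
  Lnorm mu 2%:E (fun xi => Lnorm mu 2%:E (fun tau => (k * (box r (xi, tau))%:R)%:E)) =
  (k * (2 * r * Num.sqrt a))%:E.
Proof.
move=> k0 r0.
have E xi : Lnorm mu 2%:E (fun tau => (k * (box r (xi, tau))%:R)%:E) =
    ((k * Num.sqrt (2 * r)) * cutoff (r * a) (xi - xi0))%:E.
  transitivity (Lnorm mu 2%:E (fun tau => (k * cutoff (r * a) (xi - xi0) *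
      cutoff r (tau - (tau0 + m * (xi - xi0))))%:E)).
    by apply: eq_Lnorm => tau; rewrite boxE mulrA.
  by rewrite Lnorm2_cutoff ?mulr_ge0 ?cutoff_ge0// mulrAC.
rewrite [LHS](_ : _ = Lnorm mu 2%:E (fun xi =>
  (k * Num.sqrt (2 * r) * cutoff (r * a) (xi - xi0))%:E)); last exact: eq_Lnorm.
rewrite Lnorm2_cutoff ?mulr_ge0 ?sqrtr_ge0 ?(ltW a0)//.
have r2 : 0 <= 2 * r by rewrite mulr_ge0.
have -> : Num.sqrt (2 * (r * a)) = Num.sqrt (2 * r) * Num.sqrt a.
  by rewrite mulrA sqrtrM.
by congr EFin; rewrite -{3}(sqr_sqrtr r2); ring.
Qed.

Lemma tent_box_ge0 q : 0 <= F q.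
Proof. by rewrite mulr_ge0 ?tent_ge0. Qed.

Lemma tent_box_le q : F q <= (box 1 q)%:R.
Proof.
rewrite boxE; apply: ler_pM; rewrite ?tent_ge0//.
  apply: le_trans (tent_le_cutoff _) _.
  by rewrite /cutoff normrM normfV (gtr0_norm a0) ler_pdivrMr.
by apply: le_trans (tent_le_cutoff _) _; rewrite opprD addrA.
Qed.

Lemma tent_box_ge r q : r <= 1 -> box r q -> (1 - r) ^+ 2 <= F q.
Proof.
move=> r1 /andP[q1 q2]; rewrite expr2; apply: ler_pM; rewrite ?subr_ge0//.
  by apply: tent_ge; rewrite normrM normfV (gtr0_norm a0) ler_pdivrMr.
by apply: tent_ge; move: q2; rewrite opprD addrA.
Qed.

Lemma measurable_tent_box d (T : measurableType d) (f g : T -> R) :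
  measurable_fun setT f -> measurable_fun setT g ->
  measurable_fun setT (fun x => F (f x, g x)).
Proof.
move=> mf mg; apply: measurable_funM; apply: (measurableT_comp measurable_tent).
  by apply: measurable_funM => //; exact: measurable_funB.
apply: measurable_funB; first exact: measurable_funB.
by apply: measurable_funM => //; exact: measurable_funB.
Qed.

Lemma measurable_box r : measurable_fun (setT : set plane) (fun q => (box r q)%:R : R).
Proof.
under eq_fun do rewrite boxE.
apply: measurable_funM; apply: (measurableT_comp (measurable_cutoff _)).
  exact: measurable_funB.
apply: measurable_funB => //; apply: measurable_funD => //.
by apply: measurable_funM => //; exact: measurable_funB.
Qed.

Let box_slice r xi : 0 <= r ->
  (\int[mu]_tau (box r (xi, tau))%:R%:E = (2 * r * cutoff (r * a) (xi - xi0))%:E)%E.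
Proof.
move=> r0; under eq_integral do rewrite boxE EFinM /=.
rewrite integralZl//; last exact: integrable_cutoff.
by rewrite integral_cutoff// -EFinM mulrC.
Qed.

Let box_fubini r : 0 <= r ->
  (\int[leb2]_q (box r q)%:R%:E = (2 * r * (2 * (r * a)))%:E)%E.
Proof.
move=> r0; rewrite (@fubini_tonelli1 _ _ _ _ _ mu mu) /fubini_F; last 2 first.
- by apply/measurable_EFinP; exact: measurable_box.
- by move=> q; rewrite lee_fin.
under eq_integral => xi _ do rewrite box_slice// EFinM.
rewrite integralZl//; last exact: integrable_cutoff.
by rewrite integral_cutoff ?mulr_ge0// ltW.
Qed.

Lemma integrable_box r : 0 <= r ->
  leb2.-integrable setT (fun q : plane => (box r q)%:R%:E).
Proof.
move=> r0; apply/integrableP; split.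
  by apply/measurable_EFinP; exact: measurable_box.
under eq_integral do rewrite gee0_abs ?lee_fin//.
by rewrite box_fubini// ltry.
Qed.

Lemma integral_box r : 0 <= r -> \int[leb2]_q (box r q)%:R = 4 * r ^+ 2 * a.
Proof. by move=> r0; rewrite /Rintegral box_fubini//=; ring. Qed.

(** The last factor is evaluated at minus the third convolution variable because
the transform of the conjugate is reflected. *)
Let triple (p : R * R) (z : plane * plane) : R :=
  F z.1 * F z.2 * F (- (p.1 - z.1.1 - z.2.1), - (p.2 - z.1.2 - z.2.2)).

Let Ff : R * R -> C := fun q => (F q)%:C.
Let Fr : R * R -> C := fun q => (F (- q))%:C.

Let triple_integrandE p z : conv3_integrand Ff Ff Fr p z = (triple p z)%:C.
Proof. by rewrite /conv3_integrand /Ff /Fr -!real_complexM. Qed.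

Let measurable_triple p : measurable_fun setT (triple p).
Proof.
have m11 : measurable_fun setT (fun z : plane * plane => z.1.1 : R).
  exact: measurableT_comp.
have m12 : measurable_fun setT (fun z : plane * plane => z.1.2 : R).
  exact: measurableT_comp.
have m21 : measurable_fun setT (fun z : plane * plane => z.2.1 : R).
  exact: measurableT_comp.
have m22 : measurable_fun setT (fun z : plane * plane => z.2.2 : R).
  exact: measurableT_comp.
apply: measurable_funM; first apply: measurable_funM.
- exact: (measurable_tent_box m11 m12).
- exact: (measurable_tent_box m21 m22).
- apply: (measurable_tent_box (f := fun z : plane * plane => - (p.1 - z.1.1 - z.2.1))
    (g := fun z : plane * plane => - (p.2 - z.1.2 - z.2.2))).
    apply: measurable_funN; apply: measurable_funB => //; exact: measurable_funB.
  apply: measurable_funN; apply: measurable_funB => //; exact: measurable_funB.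
Qed.

Let triple_le p z : triple p z <= (box 1 z.1)%:R * (box 1 z.2)%:R.
Proof.
have := tent_box_le (- (p.1 - z.1.1 - z.2.1), - (p.2 - z.1.2 - z.2.2)).
have := tent_box_ge0 (- (p.1 - z.1.1 - z.2.1), - (p.2 - z.1.2 - z.2.2)).
set t := F _ => t0 t1; have {}t1 : t <= 1.
  by apply: le_trans t1 _; case: box.
rewrite -[leRHS]mulr1 /triple -/t; apply: ler_pM => //.
  by apply: mulr_ge0; exact: tent_box_ge0.
by apply: ler_pM; rewrite ?tent_box_ge0 ?tent_box_le.
Qed.

Let triple_ge0 p z : 0 <= triple p z.
Proof.
by apply: mulr_ge0; first apply: mulr_ge0; exact: tent_box_ge0.
Qed.

Let triple_integrable p :
  (leb2 \x leb2)%E.-integrable setT (fun z => (triple p z)%:E).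
Proof.
have b1 := integrable_box (@ler01 R).
apply: le_integrable (integrable_tensor b1 b1) => //.
  by apply/measurable_EFinP; apply: measurable_triple.
move=> z _; rewrite lee_fin (ger0_norm (triple_ge0 p z)) ger0_norm ?mulr_ge0//.
Qed.

(** The third factor is evaluated at z.1 + z.2 - p, whose deviation from the common
centre is a signed sum of three deviations of relative size at most 1/4. *)
Let triple_ge p z : box (1 / 4) p -> box (1 / 4) z.1 -> box (1 / 4) z.2 ->
  (9 / 64) ^+ 2 <= triple p z.
Proof.
move=> bp b1 b2.
have q1 : (1 / 4 : R) <= 1 by lra.
have q3 : (3 / 4 : R) <= 1 by lra.
have b3 : box (3 / 4) (- (p.1 - z.1.1 - z.2.1), - (p.2 - z.1.2 - z.2.2)).
  move: bp b1 b2; rewrite /box /= => /andP[p1 p2] /andP[u1 u2] /andP[v1 v2].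
  move: p1 p2 u1 u2 v1 v2; rewrite !ler_norml.
  move=> /andP[p1 p1'] /andP[p2 p2'] /andP[u1 u1'] /andP[u2 u2'] /andP[v1 v1'] /andP[v2 v2'].
  apply/andP; split; apply/andP; split; lra.
have t1 := tent_box_ge q1 b1; have t2 := tent_box_ge q1 b2.
have t3 := tent_box_ge q3 b3.
rewrite /triple (_ : (9 / 64) ^+ 2 = (1 - 1 / 4) ^+ 2 * (1 - 1 / 4) ^+ 2 * (1 - 3 / 4) ^+ 2);
  last by field.
have s1 : (0 : R) <= (1 - 1 / 4) ^+ 2 by exact: sqr_ge0.
have s3 : (0 : R) <= (1 - 3 / 4) ^+ 2 by exact: sqr_ge0.
by apply: ler_pM; rewrite ?(mulr_ge0 s1 s1)//; exact: ler_pM.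
Qed.

Lemma conv3_tent_box_defined : conv3_defined Ff Ff Fr.
Proof.
apply: aeW => p.
have E : conv3_integrand Ff Ff Fr p = (fun z => (triple p z)%:C).
  by apply/funext => z; exact: triple_integrandE.
rewrite /= E; split; first exact: triple_integrable.
exact: integrable0.
Qed.

(** The integrand is at least (9 / 64)^2 when both variables are in the
parallelogram of radius 1/4, whose measure is a / 4. *)
Lemma conv3_tent_box_ge p :
  (9 / 64) ^+ 2 * (a / 4) ^+ 2 * (box (1 / 4) p)%:R <= Normc.normc (conv3 Ff Ff Fr p).
Proof.
have -> : conv3 Ff Ff Fr p = Cintegral (leb2 \x leb2)%E (fun z => (triple p z)%:C).
  by apply: eq_Cintegral => z; exact: triple_integrandE.
apply: le_trans (normc_ge_Re _); rewrite /Cintegral /=.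
have q0 : (0 : R) <= 1 / 4 by lra.
have bi := integrable_box q0.
have [bp|_] := boolP (box (1 / 4) p); last first.
  by rewrite mulr0; apply: Rintegral_ge0 => z _; exact: triple_ge0.
have -> : (9 / 64) ^+ 2 * (a / 4) ^+ 2 * true%:R =
    (9 / 64) ^+ 2 * \int[(leb2 \x leb2)%E]_z ((box (1 / 4) z.1)%:R * (box (1 / 4) z.2)%:R).
  by rewrite (Rintegral_tensor bi bi) integral_box//=; field.
have ti := integrable_tensor bi bi.
rewrite -RintegralZl//; apply: le_Rintegral => //.
- by apply: eq_integrable (integrableZl measurableT ((9 / 64) ^+ 2) ti).
- exact: triple_integrable.
- move=> z _; have [b1|_] := boolP (box (1 / 4) z.1); last first.
    by rewrite mul0r mulr0 triple_ge0.
  have [b2|_] := boolP (box (1 / 4) z.2); last by rewrite !mulr0 triple_ge0.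
  by rewrite !mulr1 triple_ge.
Qed.
End Box.

(** * Weights near the frequency N *)

Section Weights.
Context {R : realType}.
Local Notation C := (complex R).
Local Notation normC := (@Normc.normc R).

Lemma powR_le_anti (x y s : R) : 0 < x -> x <= y -> s <= 0 -> y `^ s <= x `^ s.
Proof.
move=> x0 xy s0; have y0 := lt_le_trans x0 xy.
rewrite -(opprK s) !(powRN _ (- s)) lef_pV2 ?posrE ?powR_gt0//.
by apply: ge0_ler_powR; rewrite ?oppr_ge0 ?nnegrE ?(ltW x0) ?(ltW y0).
Qed.

(** Comparing with exponents |b| and - |b| treats both signs of b at once. *)
Lemma powR_bounds (x M b : R) : 1 <= x -> x <= M ->
  M `^ (- `|b|) <= x `^ b <= M `^ `|b|.
Proof.
move=> x1 xM; have x0 : 0 < x by exact: lt_le_trans x1.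
apply/andP; split.
  apply: le_trans (powR_le_anti x0 xM _) _; first by rewrite oppr_le0.
  by apply: ler_powR => //; rewrite lerNl -normrN ler_norm.
apply: (@le_trans _ _ (x `^ `|b|)); first by apply: ler_powR => //; exact: ler_norm.
by apply: ge0_ler_powR; rewrite ?nnegrE// ?(ltW x0)// (le_trans (ltW x0)).
Qed.

Variables (alpha beta n : R).
Hypothesis n1 : 1 <= n.
Let a := n^-1.
Let N := n ^+ 2.
(* The derivative of the phase at N. *)
Let m := 2 * alpha * N + 3 * beta * N ^+ 2.
Let ph := phase alpha beta N.
Let M := 2 + `|alpha| + 4 * `|beta|.
Local Notation B := (box a m N ph).

Let n0 : 0 < n. Proof. exact: lt_le_trans n1. Qed.
Let a0 : 0 < a. Proof. by rewrite invr_gt0. Qed.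
Let a1 : a <= 1. Proof. by rewrite invf_le1. Qed.
Let N1 : 1 <= N. Proof. by rewrite exprn_ege1. Qed.
Let Na2 : N * a ^+ 2 = 1. Proof. by rewrite /N /a exprVn mulfV// expf_neq0// gt_eqF. Qed.

Lemma bracket_frequency q : B 1 q -> N <= bracket q.1 <= 3 * N.
Proof.
move=> /andP[]; rewrite mul1r ler_norml => /andP[h1 h2] _.
have := a1; have := N1; rewrite /bracket => ? ?.
by rewrite ger0_norm; last lra; apply/andP; split; lra.
Qed.

Lemma phase_taylor xi : phase alpha beta xi =
  ph + m * (xi - N) + (xi - N) ^+ 2 * (alpha + 3 * beta * N + beta * (xi - N)).
Proof. by rewrite /ph /m /phase; ring. Qed.

(** The linear part of the phase is absorbed by the parallelogram. In the
remainder h^2 (alpha + 3 beta N + beta h) the dangerous term is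
3 beta N h^2, bounded because N a^2 = 1. *)
Lemma bracket_modulation q : B 1 q ->
  1 <= bracket (q.2 - phase alpha beta q.1) <= M.
Proof.
move=> /andP[h1 h2]; rewrite /bracket lerDl normr_ge0 /=.
rewrite phase_taylor; set h := q.1 - N in h1 h2 *.
have ha : h ^+ 2 <= a ^+ 2.
  by rewrite -(real_normK (num_real h)) ler_sqr ?nnegrE ?(ltW a0)// -[a]mul1r.
have hh : h ^+ 2 <= 1 by apply: le_trans ha _; rewrite expr_le1// ltW.
have Nh : N * h ^+ 2 <= 1 by rewrite -Na2 ler_wpM2l// (le_trans ler01).
have h1' : `|h| <= 1 by apply: le_trans h1 _; rewrite mul1r.
have rem : `|h ^+ 2 * (alpha + 3 * beta * N + beta * h)| <= `|alpha| + 4 * `|beta|.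
  have -> : h ^+ 2 * (alpha + 3 * beta * N + beta * h) =
     h ^+ 2 * alpha + 3 * (N * h ^+ 2) * beta + h ^+ 2 * h * beta by ring.
  have N0 : 0 <= N := le_trans ler01 N1.
  have h20 := sqr_ge0 h.
  apply: le_trans (ler_normD _ _) _.
  apply: le_trans (lerD (ler_normD _ _) (lexx _)) _.
  have n3 : 0 <= 3 * (N * h ^+ 2) by apply: mulr_ge0 => //; exact: mulr_ge0.
  rewrite (normrM _ alpha) (normrM (3 * _)) (normrM _ beta) (normrM (h ^+ 2) h).
  rewrite (ger0_norm h20) (ger0_norm n3).
  have A0 := normr_ge0 alpha; have B0 := normr_ge0 beta; have H0 := normr_ge0 h.
  have e1 : h ^+ 2 * `|alpha| <= `|alpha| by rewrite ler_piMl.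
  have e2 : N * h ^+ 2 * `|beta| <= `|beta| by rewrite ler_piMl.
  have e3 : h ^+ 2 * `|h| * `|beta| <= `|beta|.
    by rewrite ler_piMl// mulr_ile1.
  lra.
have -> : q.2 - (ph + m * h + h ^+ 2 * (alpha + 3 * beta * N + beta * h)) =
  (q.2 - (ph + m * h)) - h ^+ 2 * (alpha + 3 * beta * N + beta * h) by ring.
by have := ler_normB (q.2 - (ph + m * h)) (h ^+ 2 * (alpha + 3 * beta * N + beta * h));
  rewrite /M; lra.
Qed.

Variable s : R.
Hypothesis s0 : s <= 0.

Let weight (b : R) (q : R * R) : R :=
  bracket q.1 `^ s * bracket (q.2 - phase alpha beta q.1) `^ b.

Let M0 : 0 < M.
Proof. by rewrite /M; have := normr_ge0 alpha; have := normr_ge0 beta; lra. Qed.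

Let weight_bounds b q : B 1 q ->
  (3 * N) `^ s * M `^ (- `|b|) <= weight b q <= N `^ s * M `^ `|b|.
Proof.
move=> Bq; have /andP[w1 w2] := bracket_frequency Bq.
have /andP[v1 v2] := bracket_modulation Bq.
have /andP[p1 p2] := powR_bounds b v1 v2.
have Np : 0 < N := lt_le_trans ltr01 N1.
apply/andP; split; apply: ler_pM; rewrite ?powR_ge0//; apply: powR_le_anti => //.
exact: lt_le_trans w1.
Qed.

Lemma Xnorm_le (b : R) (H : R * R -> C) :
  (forall q, normC (H q) <= (B 1 q)%:R) ->
  (Xnorm alpha beta s b H <= (N `^ s * M `^ `|b| * (2 * Num.sqrt a))%:E)%E.
Proof.
move=> HB; have k0 : 0 <= N `^ s * M `^ `|b| by rewrite mulr_ge0 ?powR_ge0.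
rewrite -(mulr1 2) -(Lnorm2_box m N ph a0 k0 ler01).
apply: le_Lnorm2 => xi; first exact: Lnorm_ge0.
apply: le_Lnorm2 => tau; rewrite lee_fin.
  by rewrite !mulr_ge0 ?powR_ge0//; case: (H _) => u v; exact: sqrtr_ge0.
have := HB (xi, tau); have H0 : 0 <= normC (H (xi, tau)).
  by case: (H _) => u v; exact: sqrtr_ge0.
have [Bq|_] := boolP (B 1 (xi, tau)) => hH.
  have /andP[_ w] := weight_bounds b Bq.
  by apply: ler_pM => //; rewrite mulr_ge0 ?powR_ge0.
have -> : normC (H (xi, tau)) = 0 by apply/eqP; rewrite eq_le H0 andbT.
by rewrite !mulr0.
Qed.

(** The lower bound of H is only used on the parallelogram of radius 1/4, which lies
in the one of radius 1, where the weights are controlled. *)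
Lemma Xnorm_ge (b c : R) (H : R * R -> C) : 0 <= c ->
  (forall q, c * (B (1 / 4) q)%:R <= normC (H q)) ->
  (((3 * N) `^ s * M `^ (- `|b|) * c * (Num.sqrt a / 2))%:E <=
   Xnorm alpha beta s b H)%E.
Proof.
move=> c0 HB; have k0 : 0 <= (3 * N) `^ s * M `^ (- `|b|) * c.
  by rewrite !mulr_ge0 ?powR_ge0.
have q0 : (0 : R) <= 1 / 4 by lra.
rewrite (_ : Num.sqrt a / 2 = 2 * (1 / 4) * Num.sqrt a); last by field.
rewrite -(Lnorm2_box m N ph a0 k0 q0).
apply: le_Lnorm2 => xi; first exact: Lnorm_ge0.
apply: le_Lnorm2 => tau; rewrite lee_fin; first by rewrite mulr_ge0.
rewrite -mulrA; have := HB (xi, tau).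
have [Bq|_] := boolP (B (1 / 4) (xi, tau)) => hH; last first.
  rewrite !mulr0 !mulr_ge0 ?powR_ge0//; case: (H _) => u v; exact: sqrtr_ge0.
have B1 : B 1 (xi, tau).
  move: Bq => /andP[u v]; apply/andP; split; last lra.
  by apply: le_trans u _; rewrite ler_pM2r//; lra.
have /andP[w _] := weight_bounds b B1.
by apply: ler_pM; rewrite ?mulr_ge0 ?powR_ge0.
Qed.

End Weights.

(** * Failure of the trilinear estimate *)

Section PacketSpace.
Context {R : realType}.
Local Notation C := (complex R).
Local Notation plane := (measurableTypeR R * measurableTypeR R)%type.
Variables (alpha beta s b n : R).
Hypotheses (n1 : 1 <= n) (s0 : s <= 0).
Let a := n^-1.
Let N := n ^+ 2.
Let m := 2 * alpha * N + 3 * beta * N ^+ 2.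
Let ph := phase alpha beta N.
Let M := 2 + `|alpha| + 4 * `|beta|.
Let F := tent_box a m N ph.
Let a0 : 0 < a. Proof. by rewrite invr_gt0 (lt_le_trans ltr01). Qed.

Let upper : (Xnorm alpha beta s b (fun q => (F q)%:C) <=
  (N `^ s * M `^ `|b| * (2 * Num.sqrt a))%:E)%E.
Proof.
apply: Xnorm_le => // q; rewrite normc_real ger0_norm ?tent_box_ge0//.
exact: tent_box_le.
Qed.

(** The left-hand side is the lower bound of [Xnorm_ge] for the product, the
right-hand side the cube of the upper bound of [Xnorm_le]. The absolute value
on K allows the norm of the packet to be replaced by its upper bound. *)
Lemma trilinear_at_packet (K : R) :
  (forall (u v w : functional) (uh vh wh wch : R * R -> C),
    inX alpha beta s b u uh -> inX alpha beta s b v vh ->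
    inX alpha beta s b w wh -> has_fourier (dconj w) wch ->
    conv3_defined uh vh wch ->
    (Xnorm alpha beta s (b - 1) (conv3 uh vh wch) <=
     K%:E * (Xnorm alpha beta s b uh * Xnorm alpha beta s b vh *
             Xnorm alpha beta s b wh))%E) ->
  (3 * N) `^ s * M `^ (- `|b - 1|) * ((9 / 64) ^+ 2 * (a / 4) ^+ 2) * (Num.sqrt a / 2)
  <= `|K| * (N `^ s * M `^ `|b| * (2 * Num.sqrt a)) ^+ 3.
Proof.
move=> est.
have iG := packet_integrable m N ph a0.
have mF : Cmeasurable (fun q : plane => (F q)%:C).
  apply: Cmeasurable_real.
  exact: (measurable_tent_box a m N ph measurable_fst measurable_snd).
have mFN : Cmeasurable (fun q : plane => (F (- q))%:C).
  apply: Cmeasurable_real.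
  apply: (measurable_tent_box a m N ph (f := fun q : plane => - q.1)
    (g := fun q : plane => - q.2)); exact: measurable_funN.
have uX : inX alpha beta s b (density (packet a m N ph)) (fun q => (F q)%:C).
  split; first exact: density_tempered.
    exact: packet_has_fourier.
  exact: le_lt_trans upper (ltry _).
have := est _ _ _ _ _ _ _ uX uX uX (packet_dconj_has_fourier a0 mFN)
  (conv3_tent_box_defined m N ph a0).
have c0 : 0 <= (9 / 64) ^+ 2 * (a / 4) ^+ 2 by rewrite mulr_ge0 ?sqr_ge0.
move=> /(le_trans (Xnorm_ge n1 s0 (b - 1) c0 (conv3_tent_box_ge m N ph a0))).
have X0 : (0 <= Xnorm alpha beta s b (fun q => (F q)%:C))%E by exact: Lnorm_ge0.
have Xfin : Xnorm alpha beta s b (fun q => (F q)%:C) \is a fin_num.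
  by rewrite ge0_fin_numE// (le_lt_trans upper) ?ltry.
rewrite -/F; move: upper X0; rewrite -(fineK Xfin) -!EFinM !lee_fin.
set x := fine _ => xU x0 /le_trans; apply.
apply: (@le_trans _ _ (`|K| * (x * x * x))).
  by rewrite ler_wpM2r ?ler_norm// !mulr_ge0.
rewrite ler_wpM2l// (_ : x * x * x = x ^+ 3); last by ring.
by rewrite lerXn2r ?nnegrE// (le_trans x0).
Qed.

(** Dividing by N^s a sqrt a leaves a <= D (N^s)^2 with D independent of n; here
a = 1 / n and N = n^2. *)
Lemma frequency_bound (K : R) :
  (3 * N) `^ s * M `^ (- `|b - 1|) * ((9 / 64) ^+ 2 * (a / 4) ^+ 2) * (Num.sqrt a / 2)
    <= `|K| * (N `^ s * M `^ `|b| * (2 * Num.sqrt a)) ^+ 3 ->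
  n `^ (- 1 - 4 * s) <=
    256 * `|K| * (M `^ `|b|) ^+ 3 / (3 `^ s * M `^ (- `|b - 1|) * (9 / 64) ^+ 2).
Proof.
have n0 : 0 < n := lt_le_trans ltr01 n1.
have N0 : 0 < N by rewrite exprn_gt0.
have M0 : 0 < M by rewrite /M; have := normr_ge0 alpha; have := normr_ge0 beta; lra.
rewrite powRM ?(ltW N0)//.
have S0 : 0 < Num.sqrt a by rewrite sqrtr_gt0.
have Sa : Num.sqrt a ^+ 2 = a by rewrite sqr_sqrtr// ltW.
have P0 := powR_gt0 s N0; have A0 := powR_gt0 s (ltr0n R 3).
have m10 := powR_gt0 (- `|b - 1|) M0.
have PE : n `^ (- 1 - 4 * s) = a / (N `^ s) ^+ 2.
  rewrite powRB; last by rewrite (gt_eqF n0) implybT.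
  rewrite powR_inv1 ?(ltW n0)//; congr (_ / _).
  rewrite /N -(powR_mulrn 2 (ltW n0)) -powRrM -(powR_mulrn 2) ?powR_ge0// -powRrM.
  by congr (_ `^ _); ring.
rewrite PE; move: S0 Sa P0 A0 m10.
set S := Num.sqrt a; set P := N `^ s; set A := 3 `^ s; set m1 := M `^ _; set m2 := M `^ `|b|.
move=> S0 Sa P0 A0 m10 h.
rewrite ler_pdivrMr ?exprn_gt0// mulrAC ler_pdivlMr; last by rewrite !mulr_gt0// exprn_gt0//; lra.
(* The powers of N and of sqrt a common to both sides are put back. *)
rewrite -(ler_pM2r (_ : 0 < P * S * a / 32)); last by rewrite !mulr_gt0//; lra.
have -> : a * (A * m1 * (9 / 64) ^+ 2) * (P * S * a / 32) =
  A * P * m1 * ((9 / 64) ^+ 2 * (a / 4) ^+ 2) * (S / 2) by field.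
apply: le_trans h _; rewrite le_eqVlt; apply/orP; left; apply/eqP.
by rewrite -[in RHS]Sa; field.
Qed.

End PacketSpace.

Theorem theorem4 (R : realType) (alpha beta s b : R)
    (hbeta : beta != 0) (hs : s < - (4%:R)^-1) :
  ~ exists C : R,
      forall (u v w : functional) (uh vh wh wch : R * R -> complex R),
        inX alpha beta s b u uh ->
        inX alpha beta s b v vh ->
        inX alpha beta s b w wh ->
        has_fourier (dconj w) wch ->
        conv3_defined uh vh wch ->
        (Xnorm alpha beta s (b - 1) (conv3 uh vh wch) <=
         C%:E * (Xnorm alpha beta s b uh * Xnorm alpha beta s b vh *
                 Xnorm alpha beta s b wh))%E.
Proof.
move=> [K est].
have s0 : s <= 0 by lra.
have e0 : 0 < - 1 - 4 * s by lra.
pose M := 2 + `|alpha| + 4 * `|beta|.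
pose D := 256 * `|K| * (M `^ `|b|) ^+ 3 / (3 `^ s * M `^ (- `|b - 1|) * (9 / 64) ^+ 2).
have D0 : 0 <= D.
  by rewrite divr_ge0// !mulr_ge0 ?exprn_ge0 ?powR_ge0//; lra.
(* The value of n at which n^(-1-4s) exceeds D by exactly 1. *)
pose n := (D + 1) `^ (- 1 - 4 * s)^-1.
have n1 : 1 <= n.
  rewrite -[leLHS](powRr0 (D + 1)); apply: ler_powR; first lra.
  by rewrite invr_ge0 ltW.
have := frequency_bound n1 (trilinear_at_packet n1 s0 est).
rewrite -/M -/D /n -powRrM mulVf ?gt_eqF// powRr1; lra.
Qed.
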